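(* Let $d,N\ge 1$ be integers, let $\mathsf{A}=(A_1,\ldots,A_N)\in P_d(\mathbb{R})^N$ be a tuple of $d\times d$ generalised permutation matrices, let $s$ be a real number with $0<s<d$, and define $k:=\lfloor s\rfloor$. Let $e_1,\ldots,e_d$ be the standard basis of $\mathbb{R}^d$. For $i=1,\ldots,N$ let $\pi_i\colon\{1,\ldots,d\}\to\{1,\ldots,d\}$ be the unique permutation and $a^{(i)}_1,\ldots,a^{(i)}_d$ the unique real numbers such that $A_ie_j=a^{(i)}_je_{\pi_i(j)}$ for every $i=1,\ldots,N$ and $j=1,\ldots,d$. Let $\mathfrak{S}$ denote the set of all pairs $(S,\ell)$ where $S\subset\{1,\ldots,d\}$ has exactly $k$ elements and $\ell\in\{1,\ldots,d\}\setminus S$; this set has exactly $(d-k)\binom{d}{k}$ elements. Relabel the standard basis of $\mathbb{R}^{(d-k)\binom{d}{k}}$ as $\{e_{S,\ell}\colon(S,\ell)\in\mathfrak{S}\}$. For each $i=1,\ldots,N$ define a matrix $\hat{A}_i\in P_{(d-k)\binom{d}{k}}(\mathbb{R})$ by $$\hat{A}_ie_{S,\ell}=\left(\prod_{j\in S}\left|a^{(i)}_j\right|\right)\left|a^{(i)}_\ell\right|^{s-k}e_{\pi_i(S),\pi_i(\ell)}\qquad\text{for all }(S,\ell)\in\mathfrak{S}.$$ Then $$P(\mathsf{A},s)=\log\rho\left(\sum_{i=1}^N\hat{A}_i\right).$$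
   Context: $M_d(\mathbb{R})$ denotes the space of $d\times d$ real matrices. A matrix $A\in M_d(\mathbb{R})$ is a generalised permutation matrix if it has exactly one nonzero entry in every row and in every column; $P_d(\mathbb{R})$ denotes the group of all such matrices. $\rho(A)$ denotes the spectral radius of $A$. The singular values $\alpha_1(A)\ge\cdots\ge\alpha_d(A)\ge 0$ of $A\in M_d(\mathbb{R})$ are the non-negative square roots of the eigenvalues of $A^TA$, listed in decreasing order with multiplicity. For real $s\ge 0$ the singular value function $\varphi^s\colon M_d(\mathbb{R})\to[0,+\infty)$ is defined by $\varphi^s(A):=\alpha_1(A)\alpha_2(A)\cdots\alpha_{\lfloor s\rfloor}(A)\,\alpha_{\lceil s\rceil}(A)^{s-\lfloor s\rfloor}$ if $0\le s\le d$ (the last factor being $1$ when $s$ is an integer), and $\varphi^s(A):=|\det A|^{s/d}$ if $s\ge d$. For $\mathsf{A}=(A_1,\ldots,A_N)\in M_d(\mathbb{R})^N$ and $s>0$ the pressure is the limit (which exists by subadditivity, as $\varphi^s(AB)\le\varphi^s(A)\varphi^s(B)$) $$P(\mathsf{A},s):=\lim_{n\to\infty}\frac1n\log\sum_{i_1,\ldots,i_n=1}^N\varphi^s(A_{i_n}\cdots A_{i_1})\in[-\infty,+\infty).$$ An empty product equals $1$ (relevant when $k=0$). *)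

(* Defs.v *)
From HB Require Import structures.
From mathcomp Require Import all_boot all_order all_algebra all_fingroup.
From mathcomp Require Import polyrcf complex.
From mathcomp Require Import all_classical all_reals all_analysis.

Set Implicit Arguments.
Unset Strict Implicit.
Unset Printing Implicit Defensive.
Import Order.TTheory GRing.Theory Num.Theory.
Import numFieldNormedType.Exports.
Local Open Scope classical_set_scope.
Local Open Scope ring_scope.

Definition genperm_mx (R : realType) (d : nat) (A : 'M[R]_d) : Prop :=
  (forall i, exists! j, A i j != 0) /\ (forall j, exists! i, A i j != 0).

Definition basis_vec (R : realType) (d : nat) (j : 'I_d) : 'cV[R]_d :=
  delta_mx j 0.
Arguments basis_vec {R d} j.

(* Eigenvalues are taken in R[i]; for n > 0 the set below is finite and
   nonempty, so that its supremum is a maximum. *)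
Definition spectral_radius (R : realType) (n : nat) (A : 'M[R]_n) : R :=
  sup [set Normc.normc z | z in
         [set z : R[i] | eigenvalue (map_mx (real_complex R) A) z]].

(* [rootsR p] lists the distinct roots of p in R and [mup x p] is the
   multiplicity of x in p; the symmetric matrix A^T *m A has all its
   eigenvalues in R. *)
Definition eigenvalues_with_mult (R : realType) (d : nat) (A : 'M[R]_d) :
    seq R :=
  flatten [seq nseq (mup x (char_poly A)) x | x <- rootsR (char_poly A)].

Definition singular_values (R : realType) (d : nat) (A : 'M[R]_d) : seq R :=
  sort >=%R [seq Num.sqrt x | x <- eigenvalues_with_mult (A^T *m A)].

(* Numbered from 1; the value at j = 0 only occurs in [svf 0 A], raised to
   the power 0. *)
Definition singular_value (R : realType) (d : nat) (A : 'M[R]_d) (j : nat) :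
    R :=
  nth 0 (singular_values A) j.-1.

(* [x `^ 0 = 1] for every x, including x = 0.  The two formulas agree at
   s = d. *)
Definition svf (R : realType) (d : nat) (s : R) (A : 'M[R]_d) : R :=
  if s <= d%:R then
    (\prod_(1 <= j < `|Num.floor s|.+1) singular_value A j)
      * singular_value A `|Num.ceil s| `^ (s - (Num.floor s)%:~R)
  else `|\det A| `^ (s / d%:R).

(* For w = (i_1, ..., i_n) this is A_{i_n} *m ... *m A_{i_1}. *)
Definition word_mx (R : realType) (d N : nat) (A : 'I_N -> 'M[R]_d)
    (w : seq 'I_N) : 'M[R]_d :=
  \big[mulmx/1%:M]_(i <- rev w) A i.

Definition pressure_seq (R : realType) (d N : nat) (A : 'I_N -> 'M[R]_d)
    (s : R) (n : nat) : \bar R :=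
  ((n%:R^-1)%:E * lne (\sum_(w : n.-tuple 'I_N) svf s (word_mx A w))%:E)%E.

Definition pressure (R : realType) (d N : nat) (A : 'I_N -> 'M[R]_d)
    (s : R) : \bar R :=
  limn (pressure_seq A s).

Definition pointed_subsets (d k : nat) : {set {set 'I_d} * 'I_d} :=
  [set p : {set 'I_d} * 'I_d | (#|p.1| == k) && (p.2 \notin p.1)]%SET.

(* Main.v *)
(* If M e_j = c_j e_(f j) with f injective, the singular values of M are the |c_j|,
   and svf s M is the maximum over pairs (S, l) of
   (prod_(j in S) |c_j|) * |c_l| ^ (s - k).  For the product of the A_i along a
   word w these numbers are exactly the nonzero entries of the corresponding
   product of the Ahat_i, so the sum of svf s over words of length n is, up to a
   constant factor, the sum of the entries of B^n, where B is the sum of the Ahat_i.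
   That sum is at least rho(B)^n because of an eigenvector, and at most
   K r^n for every r > rho(B): by Cayley-Hamilton the factors B - z are annihilated
   one at a time, each costing a geometric series.  Since rho(B) > 0, taking logarithms
   gives the claim. *)

Require Import Defs.
From HB Require Import structures.
From mathcomp Require Import all_boot all_order all_algebra all_fingroup.
From mathcomp Require Import polyrcf complex.
From mathcomp Require Import lra.
From mathcomp Require Import all_classical all_reals all_analysis.

Set Implicit Arguments.
Unset Strict Implicit.
Unset Printing Implicit Defensive.
Import Order.TTheory GRing.Theory Num.Theory.
Import numFieldNormedType.Exports.
Local Open Scope classical_set_scope.
Local Open Scope ring_scope.

(** * Moduli of complex numbers and geometric growth *)

Lemma normc_ge0 (R : realType) (z : R[i]) : 0 <= Normc.normc z.
Proof. by case: z => x y; exact: sqrtr_ge0. Qed.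

Lemma normc_real (R : realType) (x : R) : Normc.normc (real_complex R x) = `|x|.
Proof. by rewrite /Normc.normc /= expr0n /= addr0 sqrtr_sqr. Qed.

Lemma normcX (R : realType) (z : R[i]) n : Normc.normc (z ^+ n) = Normc.normc z ^+ n.
Proof.
elim: n => [|n IHn]; first by rewrite !expr0 Normc.normc1.
by rewrite !exprS Normc.normcM IHn.
Qed.

Lemma normc_sum (R : realType) (I : finType) (F : I -> R[i]) :
  Normc.normc (\sum_i F i) <= \sum_i Normc.normc (F i).
Proof.
elim/big_ind2: _ => [|x1 x2 y1 y2 le1 le2|//]; first by rewrite Normc.normc0.
exact: le_trans (le_normcD _ _) (lerD le1 le2).
Qed.

(** Induction on n: any K >= |x 0| with |z| K + C <= K r carries the bound from n to n + 1, and such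
    a K exists because |z| < r. *)
Lemma geometric_bound_step (R : realType) (z : R[i]) (r C : R) (x : nat -> R[i]) :
  Normc.normc z < r ->
  (forall n, Normc.normc (x n.+1 - z * x n) <= C * r ^+ n) ->
  exists K, forall n, Normc.normc (x n) <= K * r ^+ n.
Proof.
move=> zr xC; have r0 : 0 < r := le_lt_trans (normc_ge0 z) zr.
have C0 : 0 <= C.
  by have := le_trans (normc_ge0 _) (xC 0%N); rewrite expr0 mulr1.
have zr0 : 0 < r - Normc.normc z by rewrite subr_gt0.
pose K := Normc.normc (x 0%N) + C / (r - Normc.normc z).
have KC : Normc.normc z * K + C <= K * r.
  rewrite mulrC -lerBrDl -mulrBr /K mulrDl divfK ?gt_eqF// lerDr.
  by rewrite mulr_ge0 ?normc_ge0 ?ltW.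
exists K; elim=> [|n IHn].
  by rewrite expr0 mulr1 /K lerDl divr_ge0// ltW.
rewrite -[x n.+1](subrK (z * x n)).
apply: le_trans (le_normcD _ _) _; rewrite Normc.normcM.
apply: (@le_trans _ _ (Normc.normc z * (K * r ^+ n) + C * r ^+ n)).
  by rewrite addrC lerD ?xC// ler_wpM2l ?normc_ge0.
by rewrite mulrA -mulrDl exprS mulrA ler_wpM2r// exprn_ge0// ltW.
Qed.

(** Removes one root at a time. With Q the product of the remaining factors evaluated at [B], the
    entries x n of Q B^n satisfy x (n+1) - z x n = ((B - z) Q B^n)_ij, which is bounded by
    assumption, so the preceding estimate applies. *)
Lemma geometric_bound_of_annihilator (R : realType) (m : nat) (B : 'M[R[i]]_m.+1)
    (r : R) (s : seq R[i]) i j :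
  (forall z, z \in s -> Normc.normc z < r) ->
  (exists C, forall n, Normc.normc
     ((horner_mx B (\prod_(z <- s) ('X - z%:P)) * B ^+ n) i j) <= C * r ^+ n) ->
  exists K, forall n, Normc.normc ((B ^+ n) i j) <= K * r ^+ n.
Proof.
elim: s => [|z s IHs] sr [C BC].
  by exists C => n; have := BC n; rewrite big_nil rmorph1 mul1r.
apply: IHs => [y ys|]; first by apply: sr; rewrite inE ys orbT.
apply: (@geometric_bound_step _ z r C); first by apply: sr; rewrite mem_head.
move=> n; have := BC n; congr (Normc.normc _ <= _).
rewrite big_cons rmorphM rmorphB /= horner_mx_X horner_mx_C.
set Q := horner_mx B _; have QB : Q * B = B * Q.
  by apply: comm_horner_mx; exact: erefl.
by rewrite exprS mulrA QB -!mulrA mulrBl [z%:M * _]mul_scalar_mx !mxE.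
Qed.

(** * Spectral radius and growth of the powers of a matrix *)

Definition sum_norm (R : realType) (n : nat) (A : 'M[R]_n) : R :=
  \sum_i \sum_j `|A i j|.

Lemma geometric_bound_sum (R : realType) (I : finType) (f : I -> nat -> R) (r : R) :
  (forall i, exists K, forall n, f i n <= K * r ^+ n) ->
  exists K, forall n, \sum_i f i n <= K * r ^+ n.
Proof.
move=> /choice[K fK]; exists (\sum_i K i) => n.
by rewrite mulr_suml ler_sum.
Qed.

Section SpectralRadius.
Variables (R : realType) (m : nat) (B : 'M[R]_m.+1).
Let BC := map_mx (real_complex R) B.

Let mapX n i j : Normc.normc ((BC ^+ n) i j) = `|(B ^+ n) i j|.
Proof. by rewrite -[BC ^+ n]rmorphXn mxE normc_real. Qed.

(** For a row eigenvector v one has v B^n = z^n v; comparing the sums of the moduli of the entries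
    on both sides and dividing by that sum for v gives the bound. *)
Lemma eigenvalue_le_sum_norm z n :
  eigenvalue BC z -> Normc.normc z ^+ n <= sum_norm (B ^+ n).
Proof.
case/eigenvalueP => v vB v0.
have vBn : v *m BC ^+ n = z ^+ n *: v.
  elim: n => [|n IHn]; first by rewrite !expr0 scale1r mulmx1.
  by rewrite exprSr mulmxA IHn -scalemxAl vB scalerA exprSr.
have nv0 : 0 < \sum_j Normc.normc (v 0 j).
  rewrite lt_neqAle sumr_ge0 ?andbT => [|j _]; last exact: normc_ge0.
  apply: contra v0 => /eqP/esym nv0; apply/eqP/rowP => j; rewrite mxE.
  apply: Normc.eq0_normc; apply/eqP.
  move/eqP: nv0; rewrite psumr_eq0 => [/allP/(_ j)|? _]; last exact: normc_ge0.
  by rewrite mem_index_enum => /(_ isT).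
rewrite -(ler_pM2r nv0) mulr_sumr.
have -> : \sum_j Normc.normc z ^+ n * Normc.normc (v 0 j)
    = \sum_j Normc.normc (\sum_i v 0 i * (BC ^+ n) i j).
  apply: eq_bigr => j _; rewrite -normcX -Normc.normcM.
  by have /rowP/(_ j) := vBn; rewrite !mxE => ->.
have vle i : Normc.normc (v 0 i) <= \sum_j Normc.normc (v 0 j).
  by rewrite (bigD1 i)//= lerDl sumr_ge0// => j _; exact: normc_ge0.
apply: (@le_trans _ _ (\sum_j \sum_i Normc.normc (v 0 i) * `|(B ^+ n) i j|)).
  apply: ler_sum => j _; apply: le_trans (normc_sum _) _.
  by apply: ler_sum => i _; rewrite Normc.normcM mapX.
rewrite exchange_big /sum_norm mulr_suml; apply: ler_sum => i _.
by rewrite -mulr_sumr mulrC ler_wpM2l ?sumr_ge0.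
Qed.

Let eigennorms := [set Normc.normc z | z in [set z | eigenvalue BC z]].

(** Nonemptiness and boundedness make [sup] a genuine least upper bound. A root exists because the
    characteristic polynomial has positive degree and splits over [R[i]]. *)
Let eigennorms_neq0 : eigennorms !=set0.
Proof.
have [/= s sE] := closed_field_poly_normal (char_poly BC).
have : size (char_poly BC) = m.+2 by rewrite size_char_poly.
case: s sE => [->|z s sE _].
  rewrite big_nil alg_polyC => /eqP; rewrite ltn_eqF//.
  by apply: leq_ltn_trans (size_polyC_leq1 _) _.
exists (Normc.normc z), z => //=.
rewrite eigenvalue_root_char sE rootZ ?root_prod_XsubC ?mem_head//.
by rewrite lead_coef_eq0 monic_neq0// char_poly_monic.
Qed.

Let eigennorms_ub : has_ubound eigennorms.
Proof.
exists (sum_norm (B ^+ 1)) => _ [z zB <-].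
by rewrite -[Normc.normc z]expr1; exact: eigenvalue_le_sum_norm.
Qed.

Lemma spectral_radius_ge z : eigenvalue BC z -> Normc.normc z <= spectral_radius B.
Proof. by move=> zB; apply: ub_le_sup => //; exists z. Qed.

Lemma spectral_radius_ge0 : 0 <= spectral_radius B.
Proof.
case: eigennorms_neq0 => _ [z zB _].
exact: le_trans (normc_ge0 z) (spectral_radius_ge zB).
Qed.

Lemma spectral_radius_le_sum_norm n :
  (0 < n)%N -> spectral_radius B ^+ n <= sum_norm (B ^+ n).
Proof.
move=> n0; have u0 : 0 <= sum_norm (B ^+ n).
  by apply: sumr_ge0 => i _; apply: sumr_ge0.
(* The n-th root of the bound dominates the moduli themselves, so it can be compared with their
   supremum before taking n-th powers. *)
have nu : (sum_norm (B ^+ n) `^ n%:R^-1) ^+ n = sum_norm (B ^+ n).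
  by rewrite -powR_mulrn ?powR_ge0// -powRrM mulVf ?pnatr_eq0 -?lt0n// powRr1.
rewrite -[leRHS]nu lerXn2r ?nnegrE ?powR_ge0 ?spectral_radius_ge0//.
apply: ge_sup => // _ [z zB <-].
by rewrite -(ler_pXn2r n0) ?nnegrE ?powR_ge0 ?normc_ge0// nu eigenvalue_le_sum_norm.
Qed.

Lemma sum_norm_le_geometric r : spectral_radius B < r ->
  exists K, forall n, sum_norm (B ^+ n) <= K * r ^+ n.
Proof.
move=> Br; rewrite /sum_norm; apply: geometric_bound_sum => i.
apply: geometric_bound_sum => j; have [/= s sE] := closed_field_poly_normal (char_poly BC).
rewrite (monicP (char_poly_monic _)) scale1r in sE.
have [z zs||K BK] := @geometric_bound_of_annihilator R m BC r s i j.
- apply: le_lt_trans (spectral_radius_ge _) Br.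
  by rewrite eigenvalue_root_char sE root_prod_XsubC.
(* By Cayley-Hamilton the full product of factors vanishes at [BC], so the constant 0 starts the
   descent. *)
- exists 0 => n; rewrite -sE Cayley_Hamilton mul0r mxE Normc.normc0 mul0r.
  exact: lexx.
- by exists K => n; rewrite -mapX.
Qed.

End SpectralRadius.

(** * Monomial matrices and their singular values *)

Lemma monomial_mxE (R : realType) n (M : 'M[R]_n) (f : 'I_n -> 'I_n) (c : 'I_n -> R) :
  (forall j, M *m basis_vec j = c j *: basis_vec (f j)) ->
  forall i j, M i j = c j *+ (i == f j).
Proof.
move=> Mf i j; have /colP/(_ i) := Mf j.
by rewrite /basis_vec -colE !mxE eqxx andbT mulr_natr.
Qed.

Lemma monomial_genperm (R : realType) n (M : 'M[R]_n) (f : 'I_n -> 'I_n) (c : 'I_n -> R) :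
  injective f -> (forall j, c j != 0) ->
  (forall j, M *m basis_vec j = c j *: basis_vec (f j)) -> genperm_mx M.
Proof.
move=> finj c0 /monomial_mxE ME; split=> i.
  exists (invF finj i); split; first by rewrite ME f_invF eqxx c0.
  by move=> j; rewrite ME; case: (i =P f j) => [->|_]; rewrite ?invF_f ?mulr0n ?eqxx.
exists (f i); split; first by rewrite ME eqxx c0.
by move=> j; rewrite ME; case: (j =P f i) => [->|_]; rewrite ?mulr0n ?eqxx.
Qed.

Lemma genperm_monomial_neq0 (R : realType) n (M : 'M[R]_n) (f : 'I_n -> 'I_n)
    (c : 'I_n -> R) :
  genperm_mx M -> (forall j, M *m basis_vec j = c j *: basis_vec (f j)) ->
  forall j, c j != 0.
Proof.
move=> [_ Mcol] /monomial_mxE ME j; have [i [Mij _]] := Mcol j.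
by apply: contraNneq Mij => cj0; rewrite ME cj0 mul0rn.
Qed.

(** The lists are compared through the number of occurrences of each x, which on either side is the
    multiplicity of x as a root of the product of the X - v_i. *)
Lemma eigenvalues_with_mult_diag (R : realType) n (v : 'I_n -> R) (M : 'M[R]_n) :
  (forall i j, M i j = v i *+ (i == j)) ->
  perm_eq (eigenvalues_with_mult M) [seq v i | i <- enum 'I_n].
Proof.
move=> ME; have Mchar : char_poly M = \prod_(x <- [seq v i | i <- enum 'I_n]) ('X - x%:P).
  rewrite char_poly_trig; last first.
    by apply/is_trig_mxP => i j ij; rewrite ME -val_eqE ltn_eqF.
  by rewrite big_map big_enum; apply: eq_bigr => i _; rewrite ME eqxx.
have M0 : char_poly M != 0 by rewrite monic_neq0// char_poly_monic.
set s := [seq v i | i <- enum 'I_n] in Mchar *.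
rewrite /eigenvalues_with_mult; apply/allP => x _ /=; apply/eqP.
rewrite count_flatten -map_comp sumnE big_map.
rewrite (eq_bigr (fun y => (y == x) * count_mem x s)%N) => [|y _]; last first.
  rewrite /= count_nseq Mchar mu_prod_XsubC.
  by case: (eqVneq y x) => [->|/negPf yx] /=; rewrite ?eqxx ?yx.
rewrite -big_distrl /= -big_mkcond /= sum1_count count_uniq_mem ?uniq_roots//.
rewrite -(roots_on_rootsR M0) in_itv/= Mchar root_prod_XsubC.
by case: (boolP (x \in s)) => [|/count_memPn ->]; rewrite ?mul1n ?muln0.
Qed.

(** Since [f] is injective, distinct columns of [M] have disjoint supports, so M^T M is diagonal
    with entries c_j^2. *)
Lemma singular_values_monomial (R : realType) n (M : 'M[R]_n) (f : 'I_n -> 'I_n)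
    (c : 'I_n -> R) :
  injective f -> (forall j, M *m basis_vec j = c j *: basis_vec (f j)) ->
  singular_values M = sort >=%R [seq `|c j| | j <- enum 'I_n].
Proof.
move=> finj /monomial_mxE ME; rewrite /singular_values.
have nE : [seq `|c j| | j <- enum 'I_n]
    = [seq Num.sqrt x | x <- [seq c j ^+ 2 | j <- enum 'I_n]] :> seq R.
  by elim: (enum _) => //= j t ->; rewrite sqrtr_sqr.
rewrite [X in _ = sort _ X]nE.
apply/perm_sortP; [exact: ge_total|exact: ge_trans|exact: ge_anti|].
apply/perm_map/eigenvalues_with_mult_diag => i j; rewrite mxE.
rewrite (bigD1 (f i))//= big1 ?addr0 => [|l /negPf fil].
  by rewrite !mxE !ME eqxx (inj_eq finj) mulrnAr; case: eqP => [->|].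
by rewrite mxE ME fil mulr0n mul0r.
Qed.

(** * The singular value function as a maximum over pairs *)

Lemma prod_powR_le_threshold (R : realType) (I : finType) (b : I -> R) (S T : {set I})
    (l : I) (theta t : R) :
  0 < theta -> 0 <= t <= 1 -> (forall j, 0 <= b j) -> #|S| = #|T| -> l \notin S ->
  (forall j, j \in T -> theta <= b j) -> (forall j, j \notin T -> b j <= theta) ->
  (\prod_(j in S) b j) * b l `^ t <= (\prod_(j in T) b j) * theta `^ t.
Proof.
(* Each ratio x j = b j / theta is at most m j = max(1, x j), and the product of
   all the m j only sees the indices in T. *)
move=> th0 /andP[t0 t1] b0 ST lS bT bNT.
pose x j := b j / theta.
have bE j : b j = x j * theta by rewrite /x divfK// gt_eqF.
have x0 j : 0 <= x j by rewrite divr_ge0// ltW.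
have xT j : j \in T -> 1 <= x j by move=> jT; rewrite ler_pdivlMr// mul1r bT.
have xNT j : j \notin T -> x j <= 1 by move=> jT; rewrite ler_pdivrMr// mul1r bNT.
clearbody x; pose m j := Num.max 1 (x j).
have m1 j : 1 <= m j by rewrite le_max lexx.
have m0 j : 0 <= m j := le_trans ler01 (m1 j).
have xm j : x j <= m j by rewrite le_max lexx orbT.
have prod_ge1 (P : pred I) : 1 <= \prod_(j | P j) m j.
  by elim/big_ind: _ => // y z y1 z1; rewrite mulr_ege1.
have xlt : x l `^ t <= m l.
  apply: le_trans (ler1_powR (m1 l) t1).
  by apply: ge0_ler_powR; rewrite // nnegrE.
have mT : \prod_j m j = \prod_(j in T) x j.
  rewrite (bigID (mem T))/= [X in _ * X]big1 ?mulr1 => [|j jT].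
    apply: eq_bigr => j jT; by rewrite /m max_r// xT.
  by rewrite /m max_l// xNT.
(* Since |S| = |T|, both sides carry the same power of [theta], which leaves an inequality between
   the ratios. *)
suff xST : (\prod_(j in S) x j) * x l `^ t <= \prod_(j in T) x j.
  under eq_bigr do rewrite bE; under [in leRHS]eq_bigr do rewrite bE.
  rewrite bE powRM ?(ltW th0)// !big_split/= !prodr_const ST.
  rewrite mulrACA -[leRHS]mulrA ler_wpM2r//.
  by rewrite mulr_ge0 ?powR_ge0 ?exprn_ge0// ltW.
(* The factors [m j] with j outside [l |: S] are at least 1 and are dropped. *)
rewrite -mT [leRHS](bigID (fun j => j \in l |: S))/= big_setU1//=.
rewrite -[leLHS]mulr1 ler_pM ?mulr_ge0 ?prodr_ge0 ?powR_ge0//.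
by rewrite mulrC ler_pM ?powR_ge0 ?prodr_ge0// ler_prod// => j _; rewrite x0 xm.
Qed.

(** With c = [a i] and t = s - k, this is the coefficient of [Ahat i] on the basis vector of the
    pair p. *)
Definition pair_weight (R : realType) (d : nat) (t : R) (c : 'I_d -> R)
    (p : {set 'I_d} * 'I_d) : R :=
  (\prod_(j in p.1) `|c j|) * `|c p.2| `^ t.

(** With the indices sorted by decreasing |c_j|, the maximum is attained at (T, l), where T holds
    the first k indices and l is the next one; |c_l| is the threshold separating T from its
    complement. *)
Lemma singular_value_function_maximum (R : realType) (d k : nat) (s : R) (M : 'M[R]_d)
    (f : 'I_d -> 'I_d) (c : 'I_d -> R) :
  0 < s < d%:R -> k%:Z = Num.floor s -> injective f -> (forall j, c j != 0) ->
  (forall j, M *m basis_vec j = c j *: basis_vec (f j)) ->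
  (exists2 p, p \in pointed_subsets d k & svf s M = pair_weight (s - k%:R) c p) /\
  (forall p, p \in pointed_subsets d k -> pair_weight (s - k%:R) c p <= svf s M).
Proof.
move=> /andP[s0 sd] hk finj c0 Mf.
have ks : k%:R <= s by rewrite pmulrn hk floor_le.
have sk : s < k.+1%:R.
  by have /andP[_] := floor_itv s; rewrite -hk -[_ + 1]/(Posz (k + 1)) addn1.
have kd : (k < d)%N by rewrite -(ltr_nat R); exact: le_lt_trans sd.
pose l0 := Ordinal kd; pose e := relpre (fun j : 'I_d => `|c j|) >=%R.
pose js := sort e (enum 'I_d).
have etr : transitive e by move=> x y z; rewrite /e/= => yx zx; exact: le_trans yx.
have erf : reflexive e by move=> x; rewrite /e/=.
have jssort : sorted e js by apply: sort_sorted => x y; exact: le_total.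
have jsall j : j \in js by rewrite mem_sort mem_enum.
have jsU : uniq js by rewrite sort_uniq enum_uniq.
have szjs : size js = d by rewrite size_sort size_enum_ord.
pose l := nth l0 js k; pose T := [set j in take k js]%SET.
have svE j : (j < d)%N -> singular_value M j.+1 = `|c (nth l0 js j)|.
  move=> jd; rewrite /singular_value (singular_values_monomial finj Mf) sort_map.
  by rewrite (nth_map l0) ?szjs.
have inT j : (j \in T) = (index j js < k)%N by rewrite inE in_take.
have lT : l \notin T by rewrite inT index_uniq ?szjs// ltnn.
have cardT : #|T| = k.
  by rewrite cardsE; have /card_uniqP -> := take_uniq k jsU; rewrite size_takel ?szjs// ltnW.
have nthe i j : (i <= j < d)%N -> e (nth l0 js i) (nth l0 js j).
  move=> /andP[ij jd]; apply: (sorted_leq_nth etr erf) => //; rewrite inE szjs//.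
  exact: leq_ltn_trans jd.
have svfE : svf s M = pair_weight (s - k%:R) c (T, l).
  rewrite /svf (ltW sd) -hk absz_nat /pair_weight /= -pmulrn; congr (_ * _).
    rewrite big_add1 /= (eq_big_nat _ _ (F2 := fun j => `|c (nth l0 (take k js) j)|)).
      rewrite [RHS](eq_bigl (fun j => j \in take k js)) => [|j]; last by rewrite inE.
      rewrite -big_uniq ?take_uniq//= [RHS](big_nth l0) size_takel ?szjs//.
      exact: ltnW.
    by move=> j /= jk; rewrite nth_take// svE// (ltn_trans jk).
  (* If s = k, the ceiling is k instead of k + 1, but the exponent is 0 and both last factors equal
     1. *)
  have [->|/eqP sNk] := eqVneq s k%:R; first by rewrite subrr !powRr0.
  have -> : Num.ceil s = k.+1%:Z.
    apply: ceil_def; rewrite -addn1 PoszD addrK -!pmulrn addn1 (ltW sk) andbT.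
    by rewrite lt_neqAle ks eq_sym andbT; apply/eqP.
  by rewrite absz_nat svE.
split; first by exists (T, l) => //; rewrite inE /= cardT eqxx lT.
case=> S m; rewrite inE /= => /andP[/eqP cardS mS].
rewrite svfE; apply: prod_powR_le_threshold => //.
- by rewrite normr_gt0.
- by rewrite subr_ge0 ks lerBlDr -natr1 addrC in sk *; rewrite ltW.
- by rewrite cardS cardT.
- move=> j; rewrite inT => jk.
  have := @nthe (index j js) k; rewrite (ltnW jk) kd => /(_ isT).
  by rewrite nth_index.
- move=> j; rewrite inT -leqNgt => kj.
  have := @nthe k (index j js); rewrite kj -[X in (_ < X)%N]szjs index_mem jsall => /(_ isT).
  by rewrite nth_index.
Qed.

(** * Positivity of the spectral radius and logarithmic growth rates *)

(** Every column sum of B^n is at least del^n, where del is the smallest column sum of B. A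
    vanishing spectral radius would bound these sums by K (del/2)^n, so that 2^n <= K for all n,
    which is absurd. *)
Lemma spectral_radius_gt0 (R : realType) (m : nat) (B : 'M[R]_m.+1) :
  (forall i j, 0 <= B i j) -> (forall j, 0 < \sum_i B i j) -> 0 < spectral_radius B.
Proof.
move=> B0 colB.
have [q _ qmin] := arg_minP (fun j => \sum_i B i j) (isT : predT (ord0 : 'I_m.+1)).
set del := \sum_i B i q in qmin.
have del0 : 0 < del := colB q.
have BX0 n i j : 0 <= (B ^+ n) i j.
  elim: n i j => [|n IHn] i j; first by rewrite expr0 mxE; case: eqP.
  by rewrite exprS mxE sumr_ge0// => l _; rewrite mulr_ge0.
have colBX n j : del ^+ n <= \sum_i (B ^+ n) i j.
  elim: n j => [|n IHn] j.
    rewrite !expr0 (bigD1 j)//= mxE eqxx lerDl sumr_ge0// => i _.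
    by rewrite mxE; case: eqP.
  under eq_bigr do rewrite exprS mxE.
  rewrite exchange_big/=; under eq_bigr do rewrite -mulr_suml.
  apply: (@le_trans _ _ (\sum_l del * (B ^+ n) l j)).
    by rewrite -mulr_sumr exprS ler_wpM2l// ltW.
  by apply: ler_sum => l _; rewrite ler_wpM2r// qmin.
rewrite lt_neqAle spectral_radius_ge0 andbT; apply/eqP => rho0.
have [K BK] : exists K, forall n, sum_norm (B ^+ n) <= K * (del / 2) ^+ n.
  by apply: sum_norm_le_geometric; rewrite -rho0 divr_gt0.
have K2 n : 2 ^+ n <= K.
  have := BK n; rewrite expr_div_n mulrA ler_pdivlMr ?exprn_gt0// => Kn.
  rewrite -(ler_pM2l (exprn_gt0 n del0)) [leRHS]mulrC.
  apply: le_trans Kn; rewrite ler_wpM2r ?exprn_ge0//.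
  apply: le_trans (colBX n ord0) _; apply: ler_sum => i _.
  by rewrite (bigD1 ord0)//= ger0_norm// lerDl sumr_ge0.
have := K2 (Num.bound K); apply/negP; rewrite -ltNge.
have K0 : 0 <= K by have := K2 0%N; rewrite expr0; apply: le_trans.
apply: lt_trans (archi_boundP K0) _.
by rewrite -natrX ltr_nat ltn_expl.
Qed.

Lemma cvg_ln_growth (R : realType) (x : nat -> R) (rho c : R) :
  0 < rho -> 0 < c -> (forall n, (0 < n)%N -> c * rho ^+ n <= x n) ->
  (forall r, rho < r -> exists K, forall n, x n <= K * r ^+ n) ->
  (fun n => n%:R^-1 * ln (x n)) @ \oo --> ln rho.
Proof.
move=> rho0 c0 cx xK; apply/cvgrPdist_le => e e0.
have e20 : 0 < e / 2 by rewrite divr_gt0.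
(* Half of [e] enlarges the base [rho] here; the other half absorbs ln K / n below. *)
have [K {}xK] : exists K, forall n, x n <= K * (rho * expR (e / 2)) ^+ n.
  by apply: xK; rewrite ltr_pMr// expR_gt1.
have x0 n : (0 < n)%N -> 0 < x n.
  by move=> n0; apply: lt_le_trans (cx n n0); rewrite mulr_gt0 ?exprn_gt0.
have K0 : 0 < K.
  have := lt_le_trans (x0 1%N isT) (xK 1%N).
  by rewrite pmulr_lgt0// exprn_gt0// mulr_gt0 ?expR_gt0.
near=> n.
have n0 : (0 < n)%N by near: n; exact: nbhs_infty_gt.
have nR0 : 0 < n%:R :> R by rewrite ltr0n.
have lnc : - ln c <= e * n%:R.
  rewrite mulrC -ler_pdivrMr//; near: n; exact: nbhs_infty_ger.
have lnK : ln K <= (e / 2) * n%:R.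
  rewrite mulrC -ler_pdivrMr//; near: n; exact: nbhs_infty_ger.
have lo : ln c + n%:R * ln rho <= ln (x n).
  rewrite mulr_natl -lnXn// -lnM ?posrE ?exprn_gt0// ler_ln ?posrE ?x0 ?cx//.
  by rewrite mulr_gt0 ?exprn_gt0.
have up : ln (x n) <= ln K + n%:R * (ln rho + e / 2).
  rewrite -[e / 2 in leRHS]expRK -lnM ?posrE ?expR_gt0// mulr_natl -lnXn ?mulr_gt0 ?expR_gt0//.
  rewrite -lnM ?posrE ?exprn_gt0 ?mulr_gt0 ?expR_gt0// ler_ln ?posrE ?x0 ?xK//.
  by rewrite mulr_gt0 ?exprn_gt0 ?mulr_gt0 ?expR_gt0.
rewrite distrC ler_distl mulrC ler_pdivlMr// ler_pdivrMr//.
apply/andP; split.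
  by apply: le_trans lo; lra.
by apply: le_trans up _; lra.
Unshelve. all: by end_near. Qed.

(** * Products along words, and the number of pairs *)

Lemma word_mx_rcons (R : realType) (d N : nat) (A : 'I_N -> 'M[R]_d) w i :
  word_mx A (rcons w i) = A i *m word_mx A w.
Proof. by rewrite /word_mx rev_rcons big_cons. Qed.

Lemma sum_word_mx (R : realType) (m N : nat) (A : 'I_N -> 'M[R]_m.+1) n :
  \sum_(w : n.-tuple 'I_N) word_mx A w = (\sum_i A i) ^+ n.
Proof.
elim: n => [|n IHn].
  rewrite (bigD1 [tuple])//= big1 ?addr0 => [|w /eqP[]]; last exact: tuple0.
  by rewrite expr0 /word_mx big_nil.
rewrite exprS -IHn mulr_suml; under [RHS]eq_bigr do rewrite mulr_sumr.
rewrite pair_big/=.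
(* A word of length n + 1 is a last letter together with a word of length n; the last letter gives
   the leftmost factor, as in B * B^n. *)
pose h (p : 'I_N * n.-tuple 'I_N) := [tuple of rcons p.2 p.1].
have hinj : injective h.
  by move=> [i v] [j w] /(congr1 val)/= /rcons_inj[/val_inj -> ->].
have [h' hK h'K] : bijective h.
  by apply: inj_card_bij hinj _; rewrite card_prod !card_tuple card_ord expnS.
rewrite (reindex h); last by exists h' => ? _; [exact: hK|exact: h'K].
by apply: eq_bigr => -[i w] _; rewrite word_mx_rcons.
Qed.

(** Each of the C(d,k) sets S leaves d - k choices for l. *)
Lemma card_pointed_subsets d k : #|pointed_subsets d k| = ((d - k) * 'C(d, k))%N.
Proof.
rewrite -sum1_card (eq_bigl (fun p : {set 'I_d} * 'I_d => (#|p.1| == k) && (p.2 \notin p.1))).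
  rewrite -(pair_big_dep (fun S : {set 'I_d} => #|S| == k) (fun S l => l \notin S)
    (fun _ _ => 1%N))/=.
  rewrite (eq_bigr (fun=> d - k)%N) => [|S /eqP <-].
    by rewrite sum_nat_const -(card_ord d) -card_draws cardsE mulnC card_ord.
  transitivity (#|S| + #|~: S|%SET - #|S|)%N; last by rewrite cardsC card_ord.
  by rewrite addKn sum1dep_card; apply: eq_card => l; rewrite !inE.
by move=> p; rewrite inE.
Qed.

Lemma pointed_subsets_imset d k (f : {perm 'I_d}) S l :
  (S, l) \in pointed_subsets d k -> ((f @: S)%SET, f l) \in pointed_subsets d k.
Proof.
by rewrite !inE /= card_imset ?mem_imset//; exact: perm_inj.
Qed.

(** * The matrices [Ahat] and their products along words *)

Section PermutationTuples.
Variables (R : realType) (d N k m : nat) (t : R).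
Variables (A : 'I_N -> 'M[R]_d) (pi : 'I_N -> {perm 'I_d}) (a : 'I_N -> 'I_d -> R).
Hypothesis a_neq0 : forall i j, a i j != 0.
Hypothesis A_basis : forall i j, A i *m basis_vec j = a i j *: basis_vec (pi i j).
Variable idx : {set 'I_d} * 'I_d -> 'I_m.+1.
Hypothesis idx_inj : {in pointed_subsets d k &, injective idx}.
Hypothesis idx_onto : (idx @: pointed_subsets d k)%SET = [set: 'I_m.+1]%SET.
Variable Ahat : 'I_N -> 'M[R]_m.+1.
Hypothesis Ahat_basis : forall i S l, (S, l) \in pointed_subsets d k ->
  Ahat i *m basis_vec (idx (S, l)) =
    pair_weight t (a i) (S, l) *: basis_vec (idx ((pi i @: S)%SET, pi i l)).

Lemma pair_weight_gt0 (c : 'I_d -> R) p :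
  (forall j, c j != 0) -> 0 < pair_weight t c p.
Proof.
move=> c0; rewrite mulr_gt0 ?powR_gt0 ?normr_gt0// prodr_gt0// => j _.
by rewrite normr_gt0.
Qed.

(** The same [f] and [c] describe both products because weights multiply along compositions: the
    weight of j -> c_j a_(f j) at (S, l) is that of c at (S, l) times that of a at (f(S), f(l)). *)
Lemma word_mx_basis w : exists (f : {perm 'I_d}) (c : 'I_d -> R),
  [/\ forall j, c j != 0,
      forall j, word_mx A w *m basis_vec j = c j *: basis_vec (f j) &
      forall S l, (S, l) \in pointed_subsets d k ->
        word_mx Ahat w *m basis_vec (idx (S, l)) =
          pair_weight t c (S, l) *: basis_vec (idx ((f @: S)%SET, f l))].
Proof.
elim/last_ind: w => [|w i [f [c [c0 Af Ahatf]]]].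
  exists 1%g, (fun=> 1); split=> [j|j|S l _].
  - exact: oner_neq0.
  - by rewrite /word_mx big_nil mul1mx scale1r perm1.
  - rewrite /word_mx big_nil mul1mx /pair_weight /= normr1 powR1 big1 ?mulr1//.
    rewrite scale1r perm1 (eq_imset (g := id)) ?imset_id//.
    by move=> j; rewrite perm1.
exists (f * pi i)%g, (fun j => c j * a i (f j)); split=> [j|j|S l Sl].
- by rewrite mulf_neq0.
- by rewrite word_mx_rcons -mulmxA Af -scalemxAr A_basis scalerA permM.
rewrite word_mx_rcons -mulmxA Ahatf// -scalemxAr Ahat_basis; last first.
  exact: pointed_subsets_imset.
rewrite scalerA; congr (_ *: basis_vec (idx (_, _))); last by rewrite permM.
  rewrite /pair_weight /= normrM powRM// mulrACA; congr (_ * _).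
  rewrite big_imset/=; last by move=> ? ? _ _; exact: perm_inj.
  by rewrite -big_split/=; apply: eq_bigr => j _; rewrite normrM.
by rewrite -imset_comp; apply: eq_imset => j /=; rewrite permM.
Qed.

Lemma hat_column_index : exists (g : 'I_m.+1 -> {set 'I_d} * 'I_d),
  forall q, g q \in pointed_subsets d k /\ idx (g q) = q.
Proof.
suff /choice[g gP] : forall q, exists p, p \in pointed_subsets d k /\ idx p = q by exists g.
move=> q.
have : q \in (idx @: pointed_subsets d k)%SET by rewrite idx_onto inE.
by case/imsetP => p pP ->; exists p.
Qed.

(** Restates this description with columns numbered by q, where [g q] is the pair labelling column
    q; every pair occurs, so sums over columns see all weights. *)
Lemma hat_word_mx_monomial w : exists (c : 'I_d -> R) (h : 'I_m.+1 -> 'I_m.+1)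
    (g : 'I_m.+1 -> {set 'I_d} * 'I_d),
  [/\ forall q, word_mx Ahat w *m basis_vec q = pair_weight t c (g q) *: basis_vec (h q),
      injective h, forall j, c j != 0,
      (forall q, g q \in pointed_subsets d k) /\
        (forall p, p \in pointed_subsets d k -> exists q, g q = p) &
      exists2 f : 'I_d -> 'I_d, injective f &
        forall j, word_mx A w *m basis_vec j = c j *: basis_vec (f j)].
Proof.
have [f [c [c0 Af Ahatf]]] := word_mx_basis w.
have [g gP] := hat_column_index.
exists c, (fun q => idx ((f @: (g q).1)%SET, f (g q).2)), g; split=> //.
- move=> q; rewrite -[in LHS](gP q).2 {1}[g q]surjective_pairing.
  by rewrite Ahatf -?surjective_pairing ?(gP q).1.
- move=> q q' /idx_inj; rewrite !pointed_subsets_imset -?surjective_pairing ?(gP _).1//.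
  move=> /(_ isT isT)[/(imset_inj (@perm_inj _ f)) E1 /perm_inj E2].
  by rewrite -(gP q).2 -(gP q').2 [g q]surjective_pairing E1 E2 -surjective_pairing.
- split=> [q|p pP]; first exact: (gP q).1.
  by exists (idx p); apply: idx_inj; rewrite ?(gP _).1// (gP _).2.
- by exists f => //; exact: perm_inj.
Qed.

Lemma hat_word_mx_ge0 w i j : 0 <= word_mx Ahat w i j.
Proof.
have [c [h [g [/monomial_mxE -> _ c0 _ _]]]] := hat_word_mx_monomial w.
by rewrite mulrn_wge0// ltW// pair_weight_gt0.
Qed.

Lemma hat_genperm i : genperm_mx (Ahat i).
Proof.
have := hat_word_mx_monomial [:: i].
rewrite (word_mx_rcons Ahat [::]) /word_mx big_nil mulmx1.
move=> [c [h [g [Ah hinj c0 _ _]]]].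
by apply: (monomial_genperm hinj) Ah => q; rewrite gt_eqF// pair_weight_gt0.
Qed.

Lemma hat_column_sum_gt0 i j : 0 < \sum_l Ahat i l j.
Proof.
have := hat_word_mx_monomial [:: i].
rewrite (word_mx_rcons Ahat [::]) /word_mx big_nil mulmx1.
move=> [c [h [g [/monomial_mxE Ah _ c0 _ _]]]].
rewrite (bigD1 (h j))//= big1 ?addr0 => [|l /negPf lh]; last by rewrite Ah lh.
by rewrite Ah eqxx pair_weight_gt0.
Qed.

Lemma hat_ge0 i l j : 0 <= Ahat i l j.
Proof.
have := hat_word_mx_ge0 [:: i] l j.
by rewrite (word_mx_rcons Ahat [::]) /word_mx big_nil mulmx1.
Qed.

Variable s : R.
Hypotheses (sd : 0 < s < d%:R) (hk : k%:Z = Num.floor s) (ht : t = s - k%:R).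

(** Each column contributes the weight of its pair. A sum of m + 1 nonnegative terms lies between
    its largest term and m + 1 times that term, which here is the value of [svf]. *)
Lemma svf_word_bounds w :
  svf s (word_mx A w) <= sum_norm (word_mx Ahat w) <= m.+1%:R * svf s (word_mx A w).
Proof.
have [c [h [g [/monomial_mxE Ah _ c0 [gP gonto] [f finj Af]]]]] := hat_word_mx_monomial w.
have [[p pP svfE] svf_max] := singular_value_function_maximum sd hk finj c0 Af.
rewrite -ht in svfE svf_max.
have -> : sum_norm (word_mx Ahat w) = \sum_q pair_weight t c (g q).
  rewrite /sum_norm exchange_big; apply: eq_bigr => q _.
  rewrite (bigD1 (h q))//= big1 ?addr0 => [|i /negPf ih].
    by rewrite Ah eqxx gtr0_norm// pair_weight_gt0.
  by rewrite Ah ih normr0.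
apply/andP; split.
  have [q gq] := gonto p pP; rewrite svfE -gq.
  by rewrite (bigD1 q)//= lerDl sumr_ge0// => ? _; rewrite ltW// pair_weight_gt0.
apply: (@le_trans _ _ (\sum_(q < m.+1) svf s (word_mx A w))).
  by apply: ler_sum => q _; exact: svf_max (gP q).
by rewrite sumr_const card_ord mulr_natl.
Qed.

(** The hat products have nonnegative entries, so [sum_norm] is additive over the words in the
    expansion of the power, and the bounds for single words add up. *)
Lemma pressure_sum_bounds n :
  \sum_(w : n.-tuple 'I_N) svf s (word_mx A w) <= sum_norm ((\sum_i Ahat i) ^+ n)
    <= m.+1%:R * \sum_(w : n.-tuple 'I_N) svf s (word_mx A w).
Proof.
have -> : sum_norm ((\sum_i Ahat i) ^+ n)
    = \sum_(w : n.-tuple 'I_N) sum_norm (word_mx Ahat w).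
  rewrite -sum_word_mx /sum_norm [RHS]exchange_big; apply: eq_bigr => i _.
  rewrite [RHS]exchange_big; apply: eq_bigr => j _.
  rewrite summxE ger0_norm ?sumr_ge0// => [|w _]; last exact: hat_word_mx_ge0.
  by apply: eq_bigr => w _; rewrite ger0_norm// hat_word_mx_ge0.
rewrite mulr_sumr; apply/andP.
by split; apply: ler_sum => w _; have /andP[] := svf_word_bounds w.
Qed.

Hypothesis N_gt0 : (0 < N)%N.
Let rho := spectral_radius (\sum_i Ahat i).

Lemma hat_spectral_radius_gt0 : 0 < rho.
Proof.
apply: spectral_radius_gt0 => [i j|j].
  by rewrite summxE sumr_ge0// => l _; exact: hat_ge0.
under eq_bigr do rewrite summxE.
(* As N > 0, at least one summand has positive column sums. *)
rewrite exchange_big/= (bigD1 (Ordinal N_gt0))//= ltr_pwDl ?hat_column_sum_gt0//.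
by rewrite sumr_ge0// => i _; rewrite sumr_ge0// => l _; exact: hat_ge0.
Qed.

Lemma pressure_seq_cvg : pressure_seq A s @ \oo --> lne rho%:E.
Proof.
have rho0 := hat_spectral_radius_gt0.
pose x n := \sum_(w : n.-tuple 'I_N) svf s (word_mx A w).
have xlo n : (0 < n)%N -> m.+1%:R^-1 * rho ^+ n <= x n.
  move=> n0; rewrite ler_pdivrMl//; have /andP[_] := pressure_sum_bounds n.
  by apply: le_trans; exact: spectral_radius_le_sum_norm.
have x_gt0 n : (0 < n)%N -> 0 < x n.
  by move=> n0; apply: lt_le_trans (xlo n n0); rewrite mulr_gt0 ?exprn_gt0 ?invr_gt0.
have xup r : rho < r -> exists K, forall n, x n <= K * r ^+ n.
  move=> /sum_norm_le_geometric[K BK]; exists K => n; apply: le_trans (BK n).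
  by have /andP[] := pressure_sum_bounds n.
have lncvg : (fun n => n%:R^-1 * ln (x n)) @ \oo --> ln rho.
  by apply: cvg_ln_growth xlo xup; rewrite ?invr_gt0.
rewrite lne_EFin//.
apply: (@cvg_trans _ ((fun n => (n%:R^-1 * ln (x n))%:E) @ \oo)); last first.
  by apply: cvg_EFin; [exact: nearW|exact: lncvg].
(* For n > 0 the sum x n is positive, so its [lne] is the real logarithm. *)
apply: near_eq_cvg; near=> n.
have n0 : (0 < n)%N by near: n; exact: nbhs_infty_gt.
by rewrite /pressure_seq lne_EFin ?x_gt0// EFinM.
Unshelve. all: by end_near. Qed.

End PermutationTuples.

(** An arbitrary bijection [idx] from pairs to indices encodes the relabelled basis. Convergence is
    asserted beside the value, since [limn] also takes a value on divergent sequences. *)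
Theorem theorem1 (R : realType) (d N : nat) (hd : (1 <= d)%N) (hN : (1 <= N)%N)
    (A : 'I_N -> 'M[R]_d) (hA : forall i, genperm_mx (A i))
    (s : R) (hs0 : 0 < s) (hsd : s < d%:R)
    (k : nat) (hk : k%:Z = Num.floor s)
    (pi : 'I_N -> {perm 'I_d}) (a : 'I_N -> 'I_d -> R)
    (hpia : forall i j, A i *m basis_vec j = a i j *: basis_vec (pi i j)) :
  #|pointed_subsets d k| = ((d - k) * 'C(d, k))%N /\
  forall (idx : {set 'I_d} * 'I_d -> 'I_((d - k) * 'C(d, k)))
    (idx_inj : {in pointed_subsets d k &, injective idx})
    (idx_onto : (idx @: pointed_subsets d k)%SET = [set: 'I_((d - k) * 'C(d, k))]%SET)
    (Ahat : 'I_N -> 'M[R]_((d - k) * 'C(d, k)))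
    (hAhat : forall (i : 'I_N) (S : {set 'I_d}) (l : 'I_d),
      (S, l) \in pointed_subsets d k ->
      Ahat i *m basis_vec (idx (S, l)) =
      ((\prod_(j in S) `|a i j|) * `|a i l| `^ (s - k%:R))
        *: basis_vec (idx ((pi i @: S)%SET, pi i l))),
  (forall i, genperm_mx (Ahat i)) /\
  cvgn (pressure_seq A s) /\
  pressure A s = lne (spectral_radius (\sum_(i < N) Ahat i))%:E.
Proof.
split; first exact: card_pointed_subsets.
have m_gt0 : (0 < (d - k) * 'C(d, k))%N.
  have kd : (k < d)%N.
    by rewrite -(ltr_nat R); apply: le_lt_trans hsd; rewrite pmulrn hk floor_le.
  by rewrite muln_gt0 subn_gt0 kd bin_gt0 ltnW.
have a0 i := genperm_monomial_neq0 (hA i) (hpia i).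
have s0d : 0 < s < d%:R by rewrite hs0 hsd.
(* The size is rewritten as [m.+1], the form in which square matrices are a ring with powers. *)
move: ((d - k) * 'C(d, k))%N m_gt0 => [//|m] _ idx idx_inj idx_onto Ahat hAhat.
have cvg := pressure_seq_cvg a0 hpia idx_inj idx_onto hAhat s0d hk erefl hN.
split; [|split].
- exact: (hat_genperm a0 hpia idx_inj idx_onto hAhat).
- by apply/cvg_ex; eexists; exact: cvg.
- exact: cvg_lim cvg.
Qed.
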